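(* The set $\{\mathrm{AD}(G) : G \text{ a finite group}\}$ is not a closed subset of $[1,\infty)$.
   Context: For a finite group $G$, $\mathrm{Irr}(G)$ denotes the set of irreducible complex characters of $G$, and $d(\varphi)$ denotes the degree of a character $\varphi$. The Fourier anti-diagonal constant of $G$ is given by the formula $\mathrm{AD}(G)=\frac{1}{|G|}\sum_{\varphi\in\mathrm{Irr}(G)} d(\varphi)^3$ (this is known to equal the Fourier norm of the subset $\{(g,g^{-1}): g\in G\}$ of $G\times G$; the formula may be taken as the definition). The interval $[1,\infty)$ has its usual topology. *)

(* Defs.v *)
From mathcomp Require Import all_boot all_order all_algebra all_fingroup.
From mathcomp Require Import all_field all_character.
From mathcomp Require Import archimedean classical_sets reals topology normedtype.

Set Implicit Arguments.
Unset Strict Implicit.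
Unset Printing Implicit Defensive.

Import Order.TTheory GRing.Theory Num.Theory.
Import numFieldNormedType.Exports.

Local Open Scope classical_set_scope.
Local Open Scope ring_scope.

(* The degree of a character is its value at 1: a natural number, although
   stored as an element of algC (see char_degreeE). *)
Definition char_degree (gT : finGroupType) (G : {group gT}) (phi : 'CF(G)) : nat :=
  Num.truncn (phi 1%g).

Lemma char_degreeE (gT : finGroupType) (G : {group gT}) (phi : 'CF(G)) :
  phi \is a character -> (char_degree phi)%:R = phi 1%g.
Proof. by move=> Nphi; rewrite /char_degree truncnK ?Cnat_char1. Qed.

(* Valued in R rather than algC, so that its values lie in the topological
   space [1, +oo[. *)
Definition AD (R : realType) (gT : finGroupType) (G : {group gT}) : R :=
  #|G|%:R^-1 * \sum_(i : Iirr G) (char_degree 'chi_i)%:R ^+ 3.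

Definition AD_set (R : realType) : set R :=
  [set x | exists (gT : finGroupType) (G : {group gT}), x = AD R G].

Arguments AD_set R : clear implicits.

Lemma AD_ge1 (R : realType) (gT : finGroupType) (G : {group gT}) : 1 <= AD R G.
Proof.
have degE (i : Iirr G) : (char_degree 'chi_i)%:R = 'chi_i 1%g.
  by apply: char_degreeE; apply: irr_char.
have sumE : (\sum_(i : Iirr G) char_degree 'chi_i ^ 2 = #|G|)%N.
  apply/eqP; rewrite -(eqr_nat algC) natr_sum -irr_sum_square.
  by apply/eqP/eq_bigr => i _; rewrite natrX degE.
rewrite /AD mulrC ler_pdivlMr ?ltr0n ?cardG_gt0// mul1r -sumE natr_sum.
apply: ler_sum => i _; rewrite -natrX ler_nat leq_pexp2l//.
by rewrite -(ltr_nat algC) degE irr1_gt0.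
Qed.

Lemma AD_set_sub (R : realType) : AD_set R `<=` `[1, +oo[.
Proof. by move=> _ [gT [G ->]]; rewrite /= in_itv /= andbT AD_ge1. Qed.

(* Main.v *)
Require Import Defs.
From mathcomp Require Import all_boot all_order all_algebra.
From mathcomp Require Import all_fingroup all_solvable all_field all_character.
From mathcomp Require Import archimedean zify ring.
From mathcomp Require Import classical_sets reals topology normedtype sequences.
Import Order.TTheory GRing.Theory Num.Theory.
Import numFieldNormedType.Exports.
Local Open Scope classical_set_scope.
Local Open Scope ring_scope.

(** The point 2 is a limit of values of AD that is not itself a value.

Write [deg i] for the degree of the irreducible character ['chi_i].  Since the
squares of the degrees sum to |G| and there are |G : G'| linear characters,
splitting d^3 as 2 d^2 + (d - 2) d^2 gives ([AD_excess])

   AD G = 2 - 1/|G'| + E/|G|,    E = the sum of (d - 2) d^2 over degrees d > 2.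

If G has an abelian subgroup of index at most 2, all degrees are at most 2 and
AD G = 2 - 1/|G'|; dihedral 2-groups realise |G'| = 2^n for every n, so 2 is a
limit of values.

It remains to see that E is never |G : G'| ([excess_neq]).  If E = |G : G'|
then some character chi has degree d > 2.  Multiplication by the |G : G'|
linear characters sends chi to irreducible characters of the same degree d, and
each target is reached at most d^2 times, because the linear characters
carrying chi to chi' are distinct constituents of chi' chi^*
([card_twist_to_le]).  As d^2 <= (d - 2) d^2, the number of ways to reach each
character is bounded by its contribution to E; both quantities total |G : G'|,
so they agree character by character.  At the conjugate chi^* this says that
d = 3 and that exactly nine linear characters carry chi to chi^*, hence that
the square of chi^* is a sum of nine linear characters.  That is impossible
([deg3_not_full_twist]): chi^2 would equal 9 on G', so G' would lie in the
centre of chi and act through a linear character lam with lam^2 = 1 there;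
but lam^3 is the determinant of chi, which is also trivial on G'.  So G' would
lie in the kernel of chi, making chi linear. *)

(** * Degrees and the excess over 2 *)

Section Degrees.

Variables (gT : finGroupType) (G : {group gT}).
Implicit Types i j k : Iirr G.

Let deg (i : Iirr G) : nat := char_degree 'chi_i.

Lemma degE i : (deg i)%:R = 'chi_i 1%g.
Proof. exact/char_degreeE/irr_char. Qed.

Lemma deg_gt0 i : (0 < deg i)%N.
Proof. by rewrite -(ltr_nat algC) degE irr1_gt0. Qed.

Lemma lin_irr_deg i : ('chi_i \is a linear_char) = (deg i == 1)%N.
Proof. by rewrite qualifE/= irr_char /= -degE pnatr_eq1. Qed.

Lemma sum_sqr_deg : (\sum_i deg i ^ 2)%N = #|G|.
Proof.
apply/eqP; rewrite -(eqr_nat algC) natr_sum -irr_sum_square.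
by apply/eqP/eq_bigr => i _; rewrite natrX degE.
Qed.

(** The truncated subtraction makes [(d - 2) * d ^ 2] vanish at d = 1, where
d^3 falls short of 2 d^2 by one; the term |G : G'| repays that shortfall once
for each linear character. *)
Lemma sum_cube_deg :
  (\sum_i deg i ^ 3 + #|G : G^`(1)|%g =
   2 * #|G| + \sum_i (deg i - 2) * deg i ^ 2)%N.
Proof.
rewrite -card_lin_irr -sum_sqr_deg -sum1_card big_distrr /=.
rewrite [X in (_ + X)%N]big_mkcond -!big_split /=.
apply: eq_bigr => i _ /=; rewrite inE lin_irr_deg.
by have := deg_gt0 i; case: (deg i) => [|[|[|d]]] //= _; nia.
Qed.

Lemma AD_excess (R : realType) :
  AD R G = 2 - #|G^`(1)%g|%:R^-1
           + (\sum_i (deg i - 2) * deg i ^ 2)%:R / #|G|%:R.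
Proof.
have G0 : #|G|%:R != 0 :> R by rewrite pnatr_eq0 -lt0n cardG_gt0.
have D0 : #|G^`(1)%g|%:R != 0 :> R by rewrite pnatr_eq0 -lt0n cardG_gt0.
have -> : AD R G = #|G|%:R^-1 * (\sum_i deg i ^ 3)%:R.
  by rewrite /AD natr_sum; congr (_ * _); apply: eq_bigr => i _; rewrite natrX.
have /(congr1 (fun n => n%:R : R)) := sum_cube_deg.
rewrite natrD [in RHS]natrD natrM => /(canRL (addrK _)) ->.
have -> : #|G|%:R = #|G^`(1)%g|%:R * #|G : G^`(1)|%g%:R :> R.
  by rewrite -natrM Lagrange // der_sub.
have I0 : #|G : G^`(1)|%g%:R != 0 :> R by rewrite pnatr_eq0 -lt0n.
by field; rewrite D0 I0.
Qed.

(** By Frobenius reciprocity ['chi_i] is a constituent of a linear character of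
[A] induced to [G], whose degree is the index of [A]. *)
Lemma irr1_le_index_abelian (A : {group gT}) i :
  A \subset G -> abelian A -> (deg i <= #|G : A|%g)%N.
Proof.
move=> sAG abA; have [l li] := constt_cfRes_irr A i.
rewrite -(ler_nat algC) degE.
have <- : 'Ind[G] 'chi_l 1%g = #|G : A|%g%:R.
  by rewrite cfInd1 // lin_char1 ?mulr1 //; apply/char_abelianP.
by apply: char1_ge_constt; rewrite ?cfInd_char ?irr_char // constt_Ind_Res.
Qed.

(** * Twisting by linear characters *)

Definition twist_to j k : pred (Iirr G) :=
  [pred i | ('chi_i \is a linear_char) && ('chi_i * 'chi_j == 'chi_k)].

Lemma sum_card_twist_to j : (\sum_k #|twist_to j k| = #|G : G^`(1)|%g)%N.
Proof.
rewrite -card_lin_irr -sum1_card.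
rewrite [RHS](partition_big (fun i => cfIirr ('chi_i * 'chi_j)) xpredT) //=.
apply: eq_bigr => k _; rewrite sum1dep_card; apply: eq_card => i.
rewrite !inE /=.
case: (boolP ('chi_i \is a linear_char)) => //= Li.
by rewrite -(inj_eq irr_inj) cfIirrE // mul_lin_irr ?mem_irr.
Qed.

Lemma twist_to_deg j k i : i \in twist_to j k -> deg k = deg j.
Proof.
case/andP=> Li /eqP Ek; apply/eqP; rewrite -(eqr_nat algC) !degE -Ek cfunE.
by rewrite lin_char1 // mul1r.
Qed.

(** By adjunction, a linear lambda satisfies lambda chi_j = chi_k exactly when
it is a constituent of chi_k chi_j^*, and then its multiplicity is one.  So
the number of twists is controlled by the degree of that product, with the
remainder [psi] measuring how far it is from being a sum of twists. *)
Lemma sum_twist_to j k :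
  exists2 psi, psi \is a character &
    'chi_k * ('chi_j)^*%CF = \sum_(i in twist_to j k) 'chi_i + psi.
Proof.
have Nphi : 'chi_k * ('chi_j)^*%CF \is a character.
  by rewrite rpredM ?cfConjC_char ?irr_char.
exists (\sum_(i | i \notin twist_to j k)
          '['chi_k * ('chi_j)^*%CF, 'chi_i] *: 'chi_i).
  by apply: rpred_sum => i _; rewrite rpredZ_nat ?irr_char ?Cnat_cfdot_char_irr.
rewrite {1}[_ * _]cfun_sum_cfdot (bigID (mem (twist_to j k))) /=; congr (_ + _).
apply: eq_bigr => i /andP[_ /eqP Ek].
suff -> : '['chi_k * ('chi_j)^*%CF, 'chi_i] = 1 by rewrite scale1r.
rewrite -[RHS](cfnorm_irr k) -{3}Ek !cfdotE; congr (_ * _).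
by apply: eq_bigr => x _; rewrite !cfunE rmorphM -mulrA [_^* * _^*]mulrC.
Qed.

Lemma card_twist_to_le j k : (#|twist_to j k| <= deg j ^ 2)%N.
Proof.
case: (pickP (mem (twist_to j k))) => [i /twist_to_deg djk | ]; last first.
  by move/eq_card0 => ->.
have [psi Npsi /cfunP/(_ 1%g)] := sum_twist_to j k.
rewrite !cfunE sum_cfunE -!degE rmorph_nat djk.
rewrite (eq_bigr (fun=> 1)); last by move=> l /andP[/lin_char1].
rewrite sumr_const => E; rewrite -(ler_nat algC) natrX expr2 E lerDl.
exact: char1_ge0.
Qed.

(** When the count reaches the degree of chi_k chi_j^*, no room is left for the
remainder. *)
Lemma full_twist_to j k : #|twist_to j k| = (deg j ^ 2)%N ->
  'chi_k * ('chi_j)^*%CF = \sum_(i in twist_to j k) 'chi_i.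
Proof.
move=> full; have [psi Npsi E] := sum_twist_to j k; rewrite E.
suff /eqP -> : psi == 0 by rewrite addr0.
rewrite -char1_eq0 //.
have [i /twist_to_deg djk] : exists i, i \in twist_to j k.
  by apply/card_gt0P; rewrite full expn_gt0 deg_gt0.
move/cfunP/(_ 1%g): E; rewrite !cfunE sum_cfunE -!degE rmorph_nat djk.
rewrite (eq_bigr (fun=> 1)); last by move=> l /andP[/lin_char1].
rewrite sumr_const full natrX expr2 => /esym/eqP.
by rewrite -subr_eq0 addrC addKr.
Qed.

(** Nine twists from chi to chi^* force the square of chi to be constant on G',
so chi is there a multiple of a linear character; this character has order
dividing 2 because of the square and dividing 3 because of the determinant. *)
Lemma deg3_not_full_twist j :
  deg j = 3 -> #|twist_to j (conjC_Iirr j)| != 9%N.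
Proof.
move=> dj; apply/eqP => full.
have sqr9 g : g \in G^`(1)%g -> 'chi_j g ^+ 2 = 9.
  move=> G'g; have := full_twist_to j (conjC_Iirr j).
  rewrite dj full => /(_ erefl)/cfunP/(_ g).
  rewrite conjC_IirrE !cfunE sum_cfunE (eq_bigr (fun=> 1)); last first.
    move=> l /andP[Ll _]; have /fintype.subsetP/(_ _ G'g) := lin_char_der1 Ll.
    by move/cfker1 => ->; rewrite lin_char1.
  rewrite sumr_const full -expr2 => /(congr1 (fun z => z^*)).
  by rewrite rmorphXn /= conjCK rmorph_nat.
have G'G := fintype.subsetP (der_sub 1 G).
have sG'Z : G^`(1)%g \subset 'Z('chi_j)%CF.
  apply/fintype.subsetP => g G'g; rewrite irr_cfcenterE ?G'G //.
  rewrite -degE dj -(eqrXn2 (n := 2)) // -normrX sqr9 //.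
  by rewrite normr_nat -natrX.
(* On its centre, chi is three times a linear character lam. *)
have [lam Llam Elam] := cfcenter_Res 'chi_j.
have sZG := cfcenter_sub 'chi_j.
suff : 'chi_j \is a linear_char by rewrite lin_irr_deg dj.
rewrite lin_irr_der1; apply/fintype.subsetP => g G'g.
have Zg := fintype.subsetP sG'Z _ G'g.
rewrite cfkerEirr inE -degE dj.
have chig : 'chi_j g = 3 * lam g.
  by rewrite -(cfResE _ sZG Zg) Elam cfunE -degE dj.
have lam2 : lam g ^+ 2 = 1.
  have := sqr9 g G'g; rewrite chig exprMn -natrX -[RHS]mulr1.
  by apply: mulfI; rewrite pnatr_eq0.
have lam3 : lam g ^+ 3 = 1.
  (* lam^3 is the restriction of det chi, which is linear, hence trivial on
     commutators. *)
  have /(congr1 (@cfDet _ _)) := Elam.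
  rewrite -degE dj scaler_nat cfDetMn ?lin_charW //
    (cfDet_id Llam) cfDetRes ?irr_char //.
  move/cfunP/(_ g); rewrite exp_cfunE // cfResE // => <-.
  have /fintype.subsetP/(_ _ G'g)/cfker1 -> :=
    lin_char_der1 (cfDet_lin_char 'chi_j).
  exact/lin_char1/cfDet_lin_char.
by move: lam3; rewrite exprS lam2 mulr1 chig => ->; rewrite mulr1.
Qed.

(** * The excess is never |G : G'| *)

(** Twisting a character of degree d > 2 distributes the |G : G'| linear
characters among the characters of degree d, at most d^2 of them to each, which
is at most the contribution (d - 2) d^2 of each to the excess.  Equality of the totals leaves no slack at any character, in particular at the
complex conjugate of the one being twisted. *)
Lemma excess_neq : (\sum_i (deg i - 2) * deg i ^ 2 != #|G : G^`(1)|%g)%N.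
Proof.
apply/eqP => E.
have [j dj] : exists j, (2 < deg j)%N.
  apply/existsP; apply: contraT; rewrite negb_exists => /forallP le2.
  have := indexg_gt0 G G^`(1)%g; rewrite -E big1 // => i _.
  by have := le2 i; rewrite -leqNgt => /eqP ->.
(* Stated with the equality case recorded, so that the equal totals can be
   compared term by term. *)
have le k : true ->
    (#|twist_to j k| <= (deg k - 2) * deg k ^ 2 ?= iff
     (#|twist_to j k| == (deg k - 2) * deg k ^ 2))%N.
  move=> _; split=> //.
  case: (pickP (mem (twist_to j k))) => [i /twist_to_deg djk|]; last first.
    by move/eq_card0 => ->.
  apply: leq_trans (card_twist_to_le j k) _.
  by rewrite djk leq_pmull // subn_gt0.
have /leqif_sum[_] := le.
rewrite sum_card_twist_to E eqxx => /esym/forallP/(_ (conjC_Iirr j))/= /eqP full.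
have dc : deg (conjC_Iirr j) = deg j.
  by apply/eqP; rewrite -(eqr_nat algC) !degE conjC_IirrE cfunE -degE rmorph_nat.
have := card_twist_to_le j (conjC_Iirr j); rewrite full dc.
rewrite -{2}[(_ ^ 2)%N]mul1n leq_pmul2r ?expn_gt0 ?deg_gt0 // => dj3.
have {dj3}dj3 : deg j = 3 by lia.
by have /eqP[] := deg3_not_full_twist j dj3; rewrite full dc dj3.
Qed.

Lemma AD_neq2 (R : realType) : AD R G != 2.
Proof.
have G0 : #|G|%:R != 0 :> R by rewrite pnatr_eq0 -lt0n cardG_gt0.
have D0 : #|G^`(1)%g|%:R != 0 :> R by rewrite pnatr_eq0 -lt0n cardG_gt0.
apply: contra excess_neq => /eqP; rewrite AD_excess -addrA => /(canRL (addKr _)).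
rewrite addNr addrC => /subr0_eq.
move=> /(canRL (mulfVK G0)).
rewrite -(Lagrange (der_sub 1 G)) natrM mulKf //.
by move/eqP; rewrite eqr_nat.
Qed.

End Degrees.

(** * The values 2 - 1/2^n *)

Lemma AD_index2_abelian (R : realType) (gT : finGroupType) (G A : {group gT}) :
  A \subset G -> abelian A -> (#|G : A|%g <= 2)%N ->
  AD R G = 2 - #|G^`(1)%g|%:R^-1.
Proof.
move=> sAG abA iA; rewrite AD_excess big1 ?mul0r ?addr0 // => i _.
have := irr1_le_index_abelian _ _ _ i sAG abA => di.
by have /eqP -> := leq_trans di iA.
Qed.

(** The dihedral group of order 2^(n+2) has a cyclic subgroup of index 2 and a
derived subgroup of order 2^n. *)
Lemma AD_dihedral (R : realType) n : AD_set R (2 - (2 ^ n)%:R^-1).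
Proof.
pose G := [group of [set: gsort 'D_(2 ^ n.+2)]].
exists _, G.
have isoG : G \isog 'D_(2 ^ n.+2) by exact: isog_refl.
have [[x y] genG _] := generators_2dihedral (n := n.+2) isT isoG.
have [_ [_ _ oG' _] _ _] := dihedral2_structure (n := n.+2) isT genG isoG.
have [oG Gx ox _] := genG.
have sXG : <[x]>%g \subset G by rewrite cycle_subG.
rewrite (AD_index2_abelian R _ _ _ sXG (cycle_abelian x)) ?oG' /= ?subn2 //.
by rewrite -divgS // oG -orderE ox /= expnS mulnK // expn_gt0.
Qed.

(** * The set of values is not closed *)

Theorem corollary1p3 (R : realType) :
  ~ closed (AD_set R : set (subspace `[1, +oo[)).
Proof.
move=> /closed_subspaceP[V clV EV].
have V_AD x : 1 <= x -> V x <-> AD_set R x.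
  move=> x1; have I : [set` `[1, +oo[] x by rewrite /= in_itv /= andbT.
  split=> [Vx | Ax].
    by have [] : (AD_set R `&` [set` `[1, +oo[]) x by rewrite -EV.
  by have [] : (V `&` [set` `[1, +oo[]) x by rewrite EV.
have : AD_set R 2.
  apply/V_AD; first by rewrite ler1n.
  have lim2 : (fun n => 2 - (2 ^ n)%:R^-1 : R) @ \oo --> (2 : R).
    rewrite -[X in _ --> X]subr0; apply: cvgB; first exact: cvg_cst.
    have := @cvg_geometric R 1 2^-1; rewrite /geometric /=.
    rewrite ger0_norm ?invr_ge0 // invf_lt1 ?ltr1n // => /(_ isT).
    apply: cvg_trans; apply: near_eq_cvg; near=> n.
    by rewrite mul1r natrX exprVn.
  apply: (closed_cvg _ clV _ _ lim2); near=> n.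
  apply/V_AD; last exact: AD_dihedral.
  by have /(_ _ (AD_dihedral R n)) := @AD_set_sub R; rewrite /= in_itv /= andbT.
by move=> [gT [G E2]]; have := AD_neq2 _ G R; rewrite -E2 eqxx.
Unshelve. all: by end_near.
Qed.
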